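(* Let $\mu\ge0$ and $\lambda\ge0$. Let $T=\sum_{k=0}^\infty a_kD^k=h(D)e^{i\lambda D}$ be a differential operator with constant coefficients $a_k\in\mathbb{C}$, let $T^*:=\sum_{k=0}^\infty\bar a_kD^k$, and suppose that $h(w)\in\overline{\mathcal{P}}(H^* )$. If $p\in\mathcal{S}_\mu(\mathbb{R})$, then $$(T+T^* )(p(z))=h(D)p(z+i\lambda)+h^*(D)p(z-i\lambda)\in\mathcal{S}_\delta(\mathbb{R})\cup\{0\},$$ where $\delta=\sqrt{\max\{\mu^2-\lambda^2,0\}}$ and $h^*(z)=\overline{h(\bar z)}$.
   Context: $D=d/dz$; for a power series $h(w)=\sum c_kw^k$, $h(D)=\sum c_kD^k$, acting on polynomials (only finitely many terms are nonzero), and $e^{i\lambda D}p(z)=p(z+i\lambda)$. $H^*=\{z\in\mathbb{C}:\operatorname{Im}z<0\}$. For $\Omega\subseteq\mathbb{C}$, $\overline{\mathcal{P}}(\Omega)$ is the closure, under uniform limits on compact subsets of $\mathbb{C}$, of the set of polynomials having no zeros in $\Omega$. $\mathcal{S}_\mu(\mathbb{R})$ is the set of (nonzero) real polynomials all of whose zeros lie in $|\operatorname{Im}z|\le\mu$. *)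

(* Defs.v *)
From HB Require Import structures.
From mathcomp Require Import all_boot all_order all_algebra.
From mathcomp Require Import complex.
From mathcomp Require Import all_classical all_reals all_analysis.
Import numFieldNormedType.Exports.
Set Implicit Arguments.
Unset Strict Implicit.
Unset Printing Implicit Defensive.
Import Order.TTheory GRing.Theory Num.Theory.
Local Open Scope ring_scope.
Local Open Scope classical_set_scope.
Local Open Scope complex_scope.

(* The operator \sum_k c_k D^k.  The sum stops at [size p] because
   p^`(k) = 0 for k >= size p. *)
Definition diff_op (R : realType) (c : nat -> R[i]) (p : {poly R[i]}) :
    {poly R[i]} :=
  \sum_(k < size p) c k *: p^`(k).

(* Exponential series of x D; by Taylor's formula it acts as p(z) |-> p(z + x). *)
Definition exp_op (R : realType) (x : R[i]) : {poly R[i]} -> {poly R[i]} :=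
  diff_op (fun k => x ^+ k / (k`!)%:R).

(* h(w) = \sum_k c_k w^k for every complex w.  The alias R[i]^o carries the
   norm topology of the field R[i]. *)
Definition is_pseries (R : realType) (c : nat -> R[i]) (h : R[i] -> R[i]) :
    Prop :=
  forall w : R[i],
    series (fun k => c k * w ^+ k : R[i]^o) @ \oo --> (h w : R[i]^o).

Definition entire (R : realType) (h : R[i] -> R[i]) : Prop :=
  exists c, is_pseries c h.

(* The coefficients of an everywhere convergent power series are determined by
   its sum, so the choice made by [xget] is unique when h is [entire]; the
   value 0 is only used when it is not. *)
Definition pseries_coef (R : realType) (h : R[i] -> R[i]) : nat -> R[i] :=
  xget (fun=> 0) [set c | is_pseries c h].

(* h(D) *)
Definition pseries_op (R : realType) (h : R[i] -> R[i]) :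
    {poly R[i]} -> {poly R[i]} :=
  diff_op (pseries_coef h).

(* h^*(z) = conj (h (conj z)) *)
Definition conj_fun (R : realType) (h : R[i] -> R[i]) : R[i] -> R[i] :=
  fun z => (h z^*)^*.

(* The polynomial functions without zeros in Omega; this excludes the zero
   polynomial unless Omega is empty. *)
Definition nonvanishing_poly (R : realType) (Omega : set R[i]) :
    set (R[i] -> R[i]) :=
  [set f | exists2 q : {poly R[i]},
     (forall z, Omega z -> ~~ root q z) & f = horner q].

(* Closure for the topology of uniform convergence on compact subsets of the
   complex plane. *)
Definition closure_nonvanishing_poly (R : realType) (Omega : set R[i]) :
    set (R[i] -> R[i]) :=
  closure (nonvanishing_poly Omega : set {family compact, R[i]^o -> R[i]^o}).

(* H^* *)
Definition lower_half_plane (R : realType) : set R[i] :=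
  [set z | complex.Im z < 0].

(* S_mu(R) *)
Definition strip_poly (R : realType) (mu : R) : set {poly R[i]} :=
  [set p | [/\ p != 0, p \is a polyOver Num.real
             & forall z, root p z -> `|complex.Im z| <= mu]].

(* Main.v *)
(* A real polynomial [p] with zeros in [|Im z| <= mu] satisfies
   [|p(z - i lambda)| <= |p(z + i lambda)|] for [Im z > delta], by pairing every
   zero with its conjugate; thus [G = p(z + i lambda)] dominates its conjugate
   polynomial [G^*] there.  Dominance survives [G |-> (D - c) G] for
   [Im c >= 0], hence [G |-> q(D) G] for every [q] without zeros in the lower
   half-plane, so that [q(D) G + w (q(D) G)^*] has no zero above [delta] for
   [|w| < 1].  Letting [q] tend to [h] (the coefficients converge, by Cauchy's
   estimate) and [w] to [1], Hurwitz' theorem gives the zeros of [(T + T^* ) p],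
   which is real, so they avoid [Im z < - delta] too. *)
Require Import Defs.
From HB Require Import structures.
From mathcomp Require Import all_boot all_order all_algebra.
From mathcomp Require Import cyclic separable cyclotomic.
From mathcomp Require Import ring lra complex.
From mathcomp Require Import all_classical all_reals all_analysis.
Import numFieldNormedType.Exports.
Set Implicit Arguments.
Unset Strict Implicit.
Unset Printing Implicit Defensive.
Import Order.TTheory GRing.Theory Num.Theory.
Local Open Scope ring_scope.
Local Open Scope classical_set_scope.
Local Open Scope complex_scope.

(** * Zeros of polynomials below a horizontal line *)

Lemma le_norm_complex (R : rcfType) (x y : R[i]) :
  (`|x| <= `|y|) = (complex.Re x ^+ 2 + complex.Im x ^+ 2
                    <= complex.Re y ^+ 2 + complex.Im y ^+ 2).
Proof. by rewrite !normc_def lecR ler_sqrt // addr_ge0 ?sqr_ge0. Qed.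

Lemma lt_norm_complex (R : rcfType) (x y : R[i]) :
  (`|x| < `|y|) = (complex.Re x ^+ 2 + complex.Im x ^+ 2
                    < complex.Re y ^+ 2 + complex.Im y ^+ 2).
Proof. by rewrite !real_ltNge ?normr_real ?num_real // le_norm_complex. Qed.

Lemma Im_le_norm (R : rcfType) (z : R[i]) : (complex.Im z)%:C <= `|z|.
Proof.
rewrite normc_def lecR (le_trans (ler_norm _)) //.
by rewrite -sqrtr_sqr ler_sqrt ?addr_ge0 ?sqr_ge0 // lerDr sqr_ge0.
Qed.

Lemma Im_inv_lt0 (R : rcfType) (w : R[i]) :
  0 < complex.Im w -> complex.Im w^-1 < 0.
Proof.
case: w => a b /= b0; rewrite oppr_lt0 divr_gt0 //.
by rewrite ltr_wpDl ?sqr_ge0 // exprn_gt0.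
Qed.

Definition zero_free_above (R : rcfType) (d : R) (F : {poly R[i]}) : Prop :=
  forall z, d < complex.Im z -> F.[z] != 0.

Lemma zero_free_neq0 (R : rcfType) (d : R) (F : {poly R[i]}) :
  zero_free_above d F -> F != 0.
Proof.
move=> Fz; apply/negP => /eqP F0.
have := Fz (0 +i* (d + 1)); rewrite /= ltrDl ltr01 F0 horner0 eqxx.
by move=> /(_ isT).
Qed.

Lemma zero_free_factors (R : rcfType) (d : R) (F : {poly R[i]}) :
  zero_free_above d F ->
  exists2 rs : seq R[i], F = lead_coef F *: \prod_(r <- rs) ('X - r%:P)
    & {in rs, forall r, complex.Im r <= d}.
Proof.
move=> Fz; have [rs Frs] := closed_field_poly_normal F.
exists rs => // r rin; rewrite leNgt; apply/negP => /Fz /negP; apply.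
rewrite -/(root F r) Frs rootZ ?lead_coef_eq0 ?(zero_free_neq0 Fz) //.
by rewrite root_prod_XsubC.
Qed.

(** [P'/P] is the sum of the [1/(z - r)], and each term has negative imaginary part because [z - r]
    lies in the upper half-plane. *)
Lemma Im_logderiv_prod (R : rcfType) (d : R) (rs : seq R[i]) z
    (P := \prod_(r <- rs) ('X - r%:P)) :
  {in rs, forall r, complex.Im r <= d} -> d < complex.Im z ->
  P.[z] != 0 /\ (if rs is [::] then complex.Im (P^`().[z] / P.[z]) = 0
                 else complex.Im (P^`().[z] / P.[z]) < 0).
Proof.
rewrite {}/P => rsd dz; elim: rs rsd => [|r rs IH] rsd.
  by rewrite big_nil derivC hornerC horner0 mul0r oner_neq0.
have [|P0 IHle] := IH; first by move=> s sin; apply: rsd; rewrite inE sin orbT.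
have rd : complex.Im r <= d by apply: rsd; rewrite inE eqxx.
have zr : 0 < complex.Im (z - r) by rewrite raddfB /= subr_gt0 (le_lt_trans rd).
have zr0 : z - r != 0 by apply: contraTneq zr => ->; rewrite ltxx.
rewrite big_cons derivM derivXsubC mul1r hornerD !hornerM hornerXsubC.
split; first by rewrite mulf_neq0.
set P := \prod_(_ <- _) _ in P0 IHle *.
have -> : (P.[z] + (z - r) * P^`().[z]) / ((z - r) * P.[z])
    = (z - r)^-1 + P^`().[z] / P.[z] by field; apply/andP.
rewrite raddfD /= ltr_wnDr ?Im_inv_lt0 //.
by move: IHle; rewrite -/P; case: (rs) => [->|s rs0 /ltW].
Qed.

(** Scaling does not change [F'/F], so the product of linear factors decides. The equality case, a
    constant [F], serves to settle the operators [D - c] with [c] real. *)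
Lemma Im_logderiv_le0 (R : rcfType) (d : R) (F : {poly R[i]}) z :
  zero_free_above d F -> d < complex.Im z ->
  complex.Im (F^`().[z] / F.[z]) <= 0
    ?= iff (size F <= 1)%N.
Proof.
move=> Fz dz; have F0 := zero_free_neq0 Fz.
have [rs Frs rsd] := zero_free_factors Fz.
have [P0 Pd] := Im_logderiv_prod rsd dz.
have lc0 : lead_coef F != 0 by rewrite lead_coef_eq0.
have -> : (size F <= 1)%N = (rs == [::]).
  by rewrite Frs size_scale // size_prod_XsubC ltnS leqn0 size_eq0.
rewrite Frs derivZ !hornerZ -mulf_div divff // mul1r.
case: rs Pd {Frs rsd P0} => [->|s rs ltP]; first by split; rewrite ?lexx ?eqxx.
by split; [exact: ltW | rewrite lt_eqF].
Qed.

(* Factor by factor, moving from a point [z0] at distance [rho] of the roots by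
   at most [rho] increases the modulus at most by the factor [2]. *)
Lemma zero_free_growth (R : rcfType) (d : R) (F : {poly R[i]}) (z0 z : R[i]) :
  zero_free_above d F -> d < complex.Im z0 ->
  `|z - z0| <= (complex.Im z0 - d)%:C ->
  `|F.[z]| <= 2 ^+ size F * `|F.[z0]|.
Proof.
move=> Fz dz0 zz0; have [rs Frs rsd] := zero_free_factors Fz.
have lc0 : lead_coef F != 0 by rewrite lead_coef_eq0 (zero_free_neq0 Fz).
apply: (@le_trans _ _ (2 ^+ size rs * `|F.[z0]|)); last first.
  by rewrite ler_wpM2r // ler_eXn2l ?ltr1n // Frs size_scale // size_prod_XsubC.
rewrite Frs !hornerZ !normrM mulrCA ler_wpM2l // {Frs lc0}.
elim: rs rsd => [|r rs IH] rsd; first by rewrite big_nil expr0 mul1r !hornerC.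
rewrite big_cons !hornerM !hornerXsubC !normrM exprS mulrACA.
apply: ler_pM => //; last first.
  by apply: IH => s sin; apply: rsd; rewrite inE sin orbT.
rewrite -[z](subrK z0) -addrA (le_trans (ler_normD _ _)) //.
rewrite mulr_natl mulr2n lerD2r (le_trans zz0) //.
rewrite (le_trans _ (Im_le_norm _)) //.
by rewrite lecR raddfB lerB // rsd // inE eqxx.
Qed.

(* Hurwitz' theorem *)
Lemma zero_free_limit (R : rcfType) (d : R) (N : nat) (F : {poly R[i]}) :
  (forall z0 z1 (e : R[i]), 0 < e -> exists F' : {poly R[i]},
     [/\ (size F' <= N)%N, F' = 0 \/ zero_free_above d F',
         `|F'.[z0] - F.[z0]| < e & `|F'.[z1] - F.[z1]| < e]) ->
  F != 0 -> zero_free_above d F.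
Proof.
move=> Flim F0 z0 dz0; apply: contra_neq F0 => Fz0.
pose rho := complex.Im z0 - d.
have rho0 : 0 < rho by rewrite subr_gt0.
(* An approximant small at [z0] is small on the whole disc of radius [rho], with a factor [2 ^+ N]
   independent of the approximant; hence [F] vanishes on that disc. *)
have Fnear z : `|z - z0| <= rho%:C -> F.[z] = 0.
  move=> zz0; apply/eqP; rewrite -normr_le0; apply/ler_addgt0Pl => e e0.
  rewrite addr0; have e'0 : 0 < e / (1 + 2 ^+ N).
    by rewrite divr_gt0 // addr_gt0 // exprn_gt0.
  have [F' [sF' F'free]] := Flim z0 z _ e'0; rewrite Fz0 subr0 => F'z0 F'z1.
  rewrite -[F.[z]](subKr F'.[z]) (le_trans (ler_normB _ _)) //.
  have -> : e = 2 ^+ N * (e / (1 + 2 ^+ N)) + e / (1 + 2 ^+ N).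
    by field; rewrite gt_eqF // addr_gt0 // exprn_gt0.
  apply: lerD; last exact: ltW.
  case: F'free F'z0 => [->|F'free] F'z0.
    by rewrite horner0 normr0 mulr_ge0 ?exprn_ge0 // ltW.
  rewrite (le_trans (zero_free_growth F'free dz0 zz0)) //.
  rewrite ler_pM ?exprn_ge0 ?(ltW F'z0) //.
  by rewrite ler_eXn2l ?ltr1n.
(* The first [size F] of these distinct points of the disc are more roots than a nonzero [F] can
   have. *)
pose pt k : R[i] := z0 + (rho / k.+1%:R)%:C.
apply/eqP; rewrite -[F == 0]negbK; apply/negP => F0.
have := @max_poly_roots _ F (map pt (iota 0 (size F))) F0.
rewrite size_map size_iota ltnn => H; suff : false by []. apply: H.
  apply/allP => _ /mapP[k _ ->]; apply/eqP/Fnear; rewrite /pt addrC addKr.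
  rewrite ger0_norm ?ler0c ?divr_ge0 ?ler0n ?(ltW rho0) // lecR.
  by rewrite ler_pdivrMr ?ltr0Sn // ler_peMr ?(ltW rho0) // ler1n.
rewrite map_inj_uniq ?iota_uniq // => k l /addrI /complexI /(mulfI _).
by rewrite gt_eqF // => /(_ isT) /invr_inj /eqP; rewrite eqr_nat eqSS => /eqP.
Qed.

(** * Polynomials dominating their conjugate *)

Lemma horner_conj (R : rcfType) (G : {poly R[i]}) z :
  (map_poly conjc G).[z] = (G.[conjc z])^*.
Proof. by rewrite -[z in LHS]conjcK horner_map. Qed.

(** As [|G.[conjc z]|] is the modulus at [z] of the conjugate polynomial, this is a non-strict
    condition of Hermite-Biehler type. *)
Definition conj_dominated (R : rcfType) (d : R) (G : {poly R[i]}) : Prop :=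
  forall z, d < complex.Im z -> G.[z] != 0 /\ `|G.[conjc z]| <= `|G.[z]|.

(** Dominance becomes a statement on zeros, to which logarithmic derivatives apply. A zero of
    [G + w G^*] would give [|G| = |w| |G^*| < |G|]. *)
Lemma conj_dominatedP (R : rcfType) (d : R) (G : {poly R[i]}) :
  conj_dominated d G <->
  forall w, `|w| < 1 -> zero_free_above d (G + w *: map_poly conjc G).
Proof.
split=> [Gd w w1 z /Gd[Gz0 Gz]|Gw z dz].
  rewrite hornerD hornerZ horner_conj addr_eq0; apply/negP => /eqP Gz'.
  suff : `|G.[z]| < `|G.[z]| by rewrite ltxx.
  rewrite {1}Gz' normrN normrM normcJ (le_lt_trans (ler_wpM2l _ Gz)) //.
  by rewrite gtr_pMl // normr_gt0.
have Gz0 : G.[z] != 0.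
  by have /(_ _ z dz) := Gw 0; rewrite normr0 ltr01 scale0r addr0; apply.
split=> //; rewrite real_leNgt ?normr_real //; apply/negP => Gz.
have Gz'0 : G.[conjc z] != 0 by rewrite -normr_gt0 (le_lt_trans _ Gz).
(* Where dominance fails, this [w] has modulus below 1 and makes [G + w G^*] vanish at [z]. *)
have /(_ _ z dz) := Gw (- (G.[z] / (G.[conjc z])^*)).
rewrite normrN normrM normfV normcJ ltr_pdivrMr ?normr_gt0 // mul1r Gz.
rewrite hornerD hornerZ horner_conj mulNr divfK ?conjc_eq0 // subrr eqxx.
by move=> /(_ isT).
Qed.

(** A nonzero coefficient [x] cannot cancel against [w x^*], whose modulus is smaller. *)
Lemma size_add_conj (R : rcfType) (G : {poly R[i]}) w :
  `|w| < 1 -> size (G + w *: map_poly conjc G) = size G.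
Proof.
move=> w1.
have coef0 i : ((G + w *: map_poly conjc G)`_i == 0) = (G`_i == 0).
  rewrite coefD coefZ coef_map /=; apply/idP/idP => [|/eqP ->]; last first.
    by rewrite conjc0 mulr0 addr0.
  rewrite addr_eq0; apply: contraTT => Gi0; apply/negP => /eqP Gi.
  suff : `|G`_i| < `|G`_i| by rewrite ltxx.
  by rewrite {1}Gi normrN normrM normcJ gtr_pMl // normr_gt0.
apply/eqP; rewrite eqn_leq; apply/andP; split; apply/leq_sizeP => j ji;
  apply/eqP; [rewrite coef0|rewrite -coef0]; apply/eqP;
  by apply: (leq_sizeP _ _ _ j ji).
Qed.

(** With [u = y / x] in the unit disc this is the Cayley transform [(1 - u) / (1 + u)]; its real
    part is [(|x|^2 - |y|^2) / |x + y|^2]. *)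
Lemma Re_div_gt0 (R : rcfType) (x y : R[i]) :
  `|y| < `|x| -> 0 < complex.Re ((x - y) / (x + y)).
Proof.
case: x y => [a b] [c d]; rewrite lt_norm_complex /= => yx.
have n0 : 0 < (a + c) ^+ 2 + (b + d) ^+ 2.
  rewrite lt_neqAle addr_ge0 ?sqr_ge0 // andbT eq_sym paddr_eq0 ?sqr_ge0 //.
  rewrite !sqrf_eq0; apply/negP => /andP[/eqP ac /eqP bd].
  move: yx; have -> : a = - c by lra.
  by have -> : b = - d; [lra | rewrite !sqrrN ltxx].
set n := _ + _ in n0 *.
have -> : (a - c) * ((a + c) / n) - (b - d) * - ((b + d) / n)
  = (a ^+ 2 + b ^+ 2 - (c ^+ 2 + d ^+ 2)) / n by field; rewrite gt_eqF.
by rewrite divr_gt0 // subr_gt0.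
Qed.

(* For [|w| < 1], a zero of [(D - c) G + w (D - c^* ) G^*] is a solution of
   [F'/F = Re c + i Im c E/F] where [F = G + w G^*] and [E = G - w G^*]; there
   [Im (F'/F) <= 0] since [F] has its zeros below, while [Re (E/F) > 0]. *)
Lemma conj_dominated_deriv (R : rcfType) (d : R) (c : R[i]) (G : {poly R[i]}) :
  0 <= complex.Im c -> conj_dominated d G ->
  G^`() - c *: G = 0 \/ conj_dominated d (G^`() - c *: G).
Proof.
move=> c0 Gd; have Gw := (conj_dominatedP d G).1 Gd.
(* Since [G] is nonzero, [D - c] annihilates it exactly in the first case. *)
have [/andP[sG /eqP ->]|nondeg] := boolP ((size G <= 1)%N && (c == 0)).
  by left; rewrite scale0r subr0 (size1_polyC sG) derivC.
right; apply/conj_dominatedP => w w1 z dz; have Fz := Gw w w1.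
set Gs := map_poly conjc G in Fz.
have -> : map_poly conjc (G^`() - c *: G)
    = Gs^`() - ((complex.Re c)%:C - (complex.Im c)%:C * 'i) *: Gs.
  rewrite rmorphB /= linearZ /= -deriv_map -/Gs; congr (_ - _ *: _).
  by rewrite [LHS]complexE mulrC; case: (c) => x y /=; rewrite rmorphN mulNr.
pose F := G + w *: Gs; pose E := G - w *: Gs.
have -> : G^`() - c *: G
      + w *: (Gs^`() - ((complex.Re c)%:C - (complex.Im c)%:C * 'i) *: Gs)
    = F^`() - (complex.Re c)%:C *: F - ((complex.Im c)%:C * 'i) *: E.
  rewrite {1}[c]complexE /F /E derivD derivZ -!mul_polyC.
  rewrite rmorphB rmorphD !rmorphM /=; ring.
have Fz0 := Fz z dz; rewrite -/F in Fz Fz0.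
apply/negP => /eqP; rewrite !hornerD !hornerN !hornerZ => Fc.
have Fquot : F^`().[z] / F.[z]
    = (complex.Re c)%:C + (complex.Im c)%:C * 'i * (E.[z] / F.[z]).
  have -> : F^`().[z]
      = (complex.Re c)%:C * F.[z] + (complex.Im c)%:C * 'i * E.[z].
    by apply/eqP; rewrite -subr_eq0 opprD addrA Fc.
  by field.
have Re0 : 0 < complex.Re (E.[z] / F.[z]).
  rewrite /E /F !hornerD hornerN; apply: Re_div_gt0.
  have [Gz0 Gz] := Gd z dz; rewrite hornerZ horner_conj normrM normcJ.
  by rewrite (le_lt_trans (ler_wpM2l _ Gz)) // gtr_pMl ?normr_gt0.
have ImF : complex.Im (F^`().[z] / F.[z])
    = complex.Im c * complex.Re (E.[z] / F.[z]).
  by rewrite Fquot; case: (E.[z] / F.[z]) => x y; simpc; rewrite /=; ring.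
(* [Im c * Re (E/F) <= 0] forces [Im c = 0]. Then equality holds, so [F] and [G] are constant, and
   [F' = 0] forces [Re c = 0]: the excluded case. *)
have [Fle Feq] := Im_logderiv_le0 Fz dz; rewrite ImF in Fle Feq.
have Imc0 : complex.Im c = 0.
  by apply/eqP; rewrite eq_le c0 andbT -(pmulr_lle0 _ Re0).
move: Feq; rewrite Imc0 mul0r eqxx size_add_conj // => /esym sG.
move: nondeg; rewrite sG /=; apply/negP; rewrite negbK.
rewrite eq_complex Imc0 eqxx andbT.
have : (complex.Re c)%:C = 0 :> R[i].
  have := Fquot; rewrite Imc0 !mul0r addr0 => <-.
  have sF : (size F <= 1)%N by rewrite size_add_conj.
  by rewrite (size1_polyC sF) derivC horner0 mul0r.
by move/complexI => ->.
Qed.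

(** * Differential operators and the shifted polynomial *)

Lemma map_conj_real (R : rcfType) (p : {poly R[i]}) :
  (map_poly conjc p == p) = (p \is a polyOver Num.real).
Proof.
apply/eqP/polyOverP => [pE i|preal].
  by rewrite CrealE; apply/eqP; rewrite -[in RHS]pE coef_map.
apply/polyP => i; rewrite coef_map /=.
by have /complex_realP[k ->] := preal i; rewrite conjc_real.
Qed.

Lemma diff_op_wide (R : realType) (c : nat -> R[i]) (n : nat)
    (p : {poly R[i]}) :
  (size p <= n)%N -> diff_op c p = \sum_(k < n) c k *: p^`(k).
Proof.
move=> pn; rewrite /diff_op (big_ord_widen n (fun k => c k *: p^`(k))) //.
rewrite big_mkcond; apply: eq_bigr => k _; case: ltnP => // kp.
by rewrite derivn_poly0 // scaler0.
Qed.

Lemma map_conj_diff_op (R : realType) (c : nat -> R[i]) (p : {poly R[i]}) :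
  map_poly conjc (diff_op c p)
    = diff_op (fun k => (c k)^*) (map_poly conjc p).
Proof.
rewrite /diff_op size_map_poly rmorph_sum; apply: eq_bigr => k _.
by rewrite /= linearZ /= derivn_map.
Qed.

Lemma exp_op_comp (R : realType) (x : R[i]) (p : {poly R[i]}) :
  exp_op x p = p \Po ('X + x%:P).
Proof.
rewrite /comp_poly nderiv_taylor; last exact: mulrC.
rewrite size_map_poly /exp_op /diff_op; apply: eq_bigr => k _.
rewrite nderivn_map nderivn_def -/(comp_poly 'X _) comp_polyXr.
rewrite -scalerMnr scalerMnl -mulr_natr divfK ?pnatr_eq0 -?lt0n ?fact_gt0 //.
by rewrite -rmorphXn /= mulrC mul_polyC.
Qed.

Lemma map_conj_comp (R : rcfType) (p : {poly R[i]}) (l : R) :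
  p \is a polyOver Num.real ->
  map_poly conjc (p \Po ('X + (l *i)%:P)) = p \Po ('X - (l *i)%:P).
Proof.
rewrite -map_conj_real => /eqP pE; rewrite map_comp_poly /= pE.
by rewrite rmorphD /= map_polyX map_polyC /= -polyCN; simpc.
Qed.

Lemma conj_dominatedZ (R : rcfType) (d : R) (c : R[i]) (G : {poly R[i]}) :
  c != 0 -> conj_dominated d G -> conj_dominated d (c *: G).
Proof.
move=> c0 Gd z /Gd[Gz0 Gz]; rewrite !hornerZ !normrM mulf_neq0 //.
by rewrite ler_wpM2l.
Qed.

Lemma diff_op_mulXsubC (R : realType) (c : R[i]) (q G : {poly R[i]}) :
  diff_op (fun k => (('X - c%:P) * q)`_k) G
    = (diff_op (fun k => q`_k) G)^`() - c *: diff_op (fun k => q`_k) G.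
Proof.
(* Multiplication by ['X] shifts the coefficients by one: the left sum needs one more index, and its
   part from ['X * q] has no term [k = 0]. *)
rewrite (diff_op_wide _ (leqnSn (size G))).
rewrite {2}(diff_op_wide _ (leqnSn (size G))).
rewrite /diff_op linear_sum scaler_sumr /=.
under eq_bigr => k _ do rewrite mulrBl coefB coefXM mul_polyC coefZ scalerBl.
rewrite sumrB; congr (_ - _); last by apply: eq_bigr => k _; rewrite scalerA.
rewrite big_ord_recl /= scale0r add0r; apply: eq_bigr => k _.
by rewrite derivZ -derivnS.
Qed.

(** [q(D)] is a nonzero constant times a product of operators [D - r] with [Im r >= 0], each of
    which preserves dominance or gives 0. *)
Lemma conj_dominated_diff_op (R : realType) (d : R) (q G : {poly R[i]}) :
  (forall z, complex.Im z < 0 -> ~~ root q z) -> conj_dominated d G ->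
  diff_op (fun k => q`_k) G = 0 \/ conj_dominated d (diff_op (fun k => q`_k) G).
Proof.
move=> qz Gd; have q0 : q != 0.
  apply/negP => /eqP q0; have := qz (0 +i* (-1)); rewrite q0 root0 /= ltrN10.
  by move=> /(_ isT).
have [rs qrs] := closed_field_poly_normal q.
have lc0 : lead_coef q != 0 by rewrite lead_coef_eq0.
have rs0 : {in rs, forall r, 0 <= complex.Im r}.
  move=> r rin; rewrite leNgt; apply/negP => /qz /negP; apply.
  by rewrite qrs rootZ // root_prod_XsubC.
set c := lead_coef q in qrs lc0; rewrite {}qrs.
have -> : diff_op (fun k => (c *: \prod_(r <- rs) ('X - r%:P))`_k) G
    = c *: diff_op (fun k => (\prod_(r <- rs) ('X - r%:P))`_k) G.
  rewrite /diff_op scaler_sumr; apply: eq_bigr => k _.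
  by rewrite coefZ scalerA.
suff [->|Hd] : diff_op (fun k => (\prod_(r <- rs) ('X - r%:P))`_k) G = 0
    \/ conj_dominated d (diff_op (fun k => (\prod_(r <- rs) ('X - r%:P))`_k) G).
- by left; rewrite scaler0.
- by right; apply: conj_dominatedZ.
elim: rs rs0 => [|r rs IH] rs0.
  right; rewrite big_nil (diff_op_wide _ (leqnSn (size G))) big_ord_recl.
  rewrite big1 ?addr0 => [|k _]; last by rewrite coefC /= scale0r.
  by rewrite coefC /= scale1r.
rewrite big_cons diff_op_mulXsubC.
have r0 : 0 <= complex.Im r by apply: rs0; rewrite inE eqxx.
have [|->|Hd] := IH; first by move=> s sin; apply: rs0; rewrite inE sin orbT.
- by left; rewrite deriv0 scaler0 subr0.
- exact: conj_dominated_deriv.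
Qed.

(** As [|w^* - r| = |w - r^*|], each side pairs the factors of [r] and its conjugate. With
    [z = x + i y] and [r = a + i b], the squares of the sides differ by
    [8 y l ((x - a)^2 + y^2 + l^2 - b^2)]. *)
Lemma norm_factor_shift (R : rcfType) (z r : R[i]) (l : R) :
  0 <= l -> 0 <= complex.Im z ->
  complex.Im r ^+ 2 <= complex.Im z ^+ 2 + l ^+ 2 ->
  `|z - l *i - r| * `|(z - l *i)^* - r|
    <= `|z + l *i - r| * `|(z + l *i)^* - r|.
Proof.
case: z r => [x y] [a b] /= l0 y0 b_le.
rewrite -!normrM le_norm_complex /= -subr_ge0.
set t := (X in 0 <= X).
have -> : t = ((x - a) ^+ 2 + (y ^+ 2 + l ^+ 2 - b ^+ 2)) * (y * l)
              * 8 by rewrite /t; ring.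
rewrite mulr_ge0 // mulr_ge0 ?[0 <= y * l]mulr_ge0 //.
by have := sqr_ge0 (x - a); lra.
Qed.

(* For real [p] the identity [|p(w)|^2 = |p(w)| |p(w^* )|] allows one to pair
   the factors of [r] and of its conjugate. *)
Lemma conj_dominated_shift (R : rcfType) (mu l : R) (p : {poly R[i]}) :
  0 <= l -> p != 0 -> p \is a polyOver Num.real ->
  (forall z, root p z -> `|complex.Im z| <= mu) ->
  conj_dominated (Num.sqrt (Num.max (mu ^+ 2 - l ^+ 2) 0))
    (p \Po ('X + (l *i)%:P)).
Proof.
move=> l0 p0 preal pmu z; set M := Num.max _ _ => zd.
have z0 : 0 < complex.Im z by rewrite (le_lt_trans _ zd) // sqrtr_ge0.
have Mz : M < complex.Im z ^+ 2.
  rewrite -[M]sqr_sqrtr ?le_max ?lexx ?orbT //.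
  by rewrite ltr_pXn2r // nnegrE ?sqrtr_ge0 ?ltW.
have muz r : root p r -> complex.Im r ^+ 2 < complex.Im z ^+ 2 + l ^+ 2.
  move=> /pmu rmu; have : complex.Im r ^+ 2 <= mu ^+ 2.
    by rewrite -real_normK ?num_real // lerXn2r // nnegrE (le_trans _ rmu).
  have : mu ^+ 2 - l ^+ 2 <= M by rewrite le_max lexx.
  by move: Mz; lra.
have hornerS x : (p \Po ('X + (l *i)%:P)).[x] = p.[x + l *i].
  by rewrite horner_comp !hornerE.
rewrite !hornerS; split.
  (* For a zero at [z + i l], [muz] would give [(Im z + l)^2 < (Im z)^2 + l^2], although [Im z] and
     [l] are nonnegative. *)
  apply/negP => /muz; rewrite raddfD /= sqrrD addrAC.
  by rewrite gtrDl; apply/negP; rewrite -leNgt mulrn_wge0 // mulr_ge0 // ltW.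
have pconj x : p.[conjc x] = (p.[x])^*.
  move: preal; rewrite -map_conj_real => /eqP {1}<-.
  by rewrite horner_conj conjcK.
(* For real [p], the value at [conjc z + i l] thus has the modulus of [p(z - i l)]. *)
have -> : conjc z + l *i = conjc (z - l *i).
  case: (z) => x y; apply/eqP; rewrite eq_complex /=.
  by apply/andP; split; apply/eqP; ring.
rewrite pconj normcJ -(@ler_pXn2r _ 2) ?nnegrE //.
have sqrp x : `|p.[x]| ^+ 2 = `|p.[x]| * `|p.[conjc x]| by rewrite pconj normcJ.
rewrite !{}sqrp; have [rs prs] := closed_field_poly_normal p.
have rsz r : r \in rs -> root p r.
  by move=> rin; rewrite prs rootZ ?lead_coef_eq0 // root_prod_XsubC.
set c := lead_coef p in prs; rewrite {}prs {hornerS pconj p0 preal pmu}.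
rewrite !hornerZ !normrM [leLHS]mulrACA [leRHS]mulrACA.
rewrite ler_wpM2l ?mulr_ge0 //.
elim: rs rsz => [|r rs IH] rsz; first by rewrite big_nil !hornerC.
rewrite big_cons !hornerM !hornerXsubC !normrM.
rewrite [leLHS]mulrACA [leRHS]mulrACA.
apply: ler_pM; rewrite ?mulr_ge0 //; last first.
  by apply: IH => s sin; apply: rsz; rewrite inE sin orbT.
apply: norm_factor_shift => //; first exact: ltW.
by apply/ltW/muz/rsz; rewrite inE eqxx.
Qed.

(** * Coefficients of entire power series *)

(** In characteristic 0 the polynomial [X^n - 1] is separable, so it has [n] distinct roots, and one
    of them is primitive. *)
Lemma prim_root_exists (C : numClosedFieldType) n :
  (n > 0)%N -> exists z : C, n.-primitive_root z.
Proof.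
move=> n_gt0; have [r Dp] := closed_field_poly_normal ('X^n - 1 : {poly C}).
rewrite (monicP _) ?monicXnsubC // scale1r in Dp.
have rn1 : all n.-unity_root r by apply/allP=> z; rewrite -root_prod_XsubC -Dp.
have sz_r : (n < (size r).+1)%N.
  by rewrite -(size_prod_XsubC r id) -Dp size_XnsubC.
have [|z] := hasP (has_prim_root n_gt0 rn1 _ sz_r); last by exists z.
by rewrite -separable_prod_XsubC -Dp separable_Xn_sub_1 // pnatr_eq0 -lt0n.
Qed.

(* Fourier inversion on the [n]-th roots of unity. *)
Lemma coef_root_unity_avg (C : numClosedFieldType) (z : C) n (c : nat -> C) k :
  n.-primitive_root z -> (k < n)%N ->
  c k *+ n = \sum_(j < n) z ^- (j * k) * \sum_(m < n) c m * (z ^+ j) ^+ m.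
Proof.
move=> zp kn; have z0 : z != 0.
  by rewrite (prim_root_eq0 zp) -lt0n (leq_ltn_trans _ kn).
under eq_bigr => j _ do rewrite mulr_sumr.
rewrite exchange_big /= (bigD1 (Ordinal kn)) //= [X in _ + X]big1 ?addr0.
  rewrite (eq_bigr (fun=> c k)); first by rewrite sumr_const card_ord.
  by move=> j _; rewrite -exprM mulrCA mulVf ?mulr1 // expf_neq0.
(* For [m != k] the sum over [j] is geometric with ratio [t != 1] and [t^n = 1], so it vanishes. *)
move=> m mk; pose t := z ^+ m / z ^+ k.
rewrite (eq_bigr (fun j : 'I_n => c m * t ^+ j)); last first.
  move=> j _; rewrite mulrCA expr_div_n -!exprM; congr (_ * _).
  by rewrite mulrC mulnC [(j * k)%N]mulnC.
rewrite -mulr_sumr; suff -> : \sum_(j < n) t ^+ j = 0 by rewrite mulr0.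
have t1 : t != 1.
  apply: contra mk => /eqP t1; have : z ^+ m == z ^+ k.
    by rewrite -[z ^+ k]mul1r -t1 divfK // expf_neq0.
  by rewrite (eq_prim_root_expr zp) !modn_small // -val_eqE.
apply: (@mulfI _ (t - 1)); first by rewrite subr_eq0.
rewrite mulr0 -subrX1 expr_div_n -!exprM ![(_ * n)%N]mulnC !exprM.
by rewrite (prim_expr_order zp) !expr1n divr1 subrr.
Qed.

Lemma is_pseries_near (R : realType) (c : nat -> R[i]) (h : R[i] -> R[i]) w e :
  is_pseries c h -> 0 < e ->
  exists N, forall n, (N <= n)%N -> `|h w - \sum_(k < n) c k * w ^+ k| < e.
Proof.
move=> /(_ w) /cvgrPdist_lt /(_ e) H /H [N _ HN]; exists N => n /HN.
by rewrite /= /series /= big_mkord.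
Qed.

Lemma is_pseriesP (R : realType) (c : nat -> R[i]) (h : R[i] -> R[i]) :
  (forall w e, 0 < e -> exists N, forall n, (N <= n)%N ->
      `|h w - \sum_(k < n) c k * w ^+ k| < e) -> is_pseries c h.
Proof.
move=> H w; apply/cvgrPdist_lt => e /(H w)[N HN]; exists N => // n /HN.
by rewrite /= /series /= big_mkord.
Qed.

(* Terms of a power series converging at [2] are [O(2^-k)]. *)
Lemma is_pseries_tail (R : realType) (c : nat -> R[i]) (h : R[i] -> R[i]) :
  is_pseries c h -> exists2 M : R, 0 < M & forall w n, `|w| <= 1 ->
    `|h w - \sum_(k < n) c k * w ^+ k| <= (M / 2 ^+ n)%:C.
Proof.
move=> ch; have [N HN] := is_pseries_near 2 ch ltr01.
pose t k : R[i] := `|c k * 2 ^+ k|.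
have [M M0 tM] : exists2 M : R, 0 < M & forall k, t k <= M%:C.
  have SM n : exists2 M : R, 0 <= M & \sum_(k < n) t k = M%:C.
    have S0 : 0 <= \sum_(k < n) t k by apply: sumr_ge0 => k _; exact: normr_ge0.
    have SE := RRe_real (ger0_real S0).
    by exists (complex.Re (\sum_(k < n) t k)); rewrite -?ler0c SE.
  have [M0 M00 eM] := SM N; exists (M0 + 2); first by rewrite ltr_wpDl.
  move=> k; case: (ltnP k N) => [kN|Nk].
    rewrite rmorphD /= -eM (bigD1 (Ordinal kN)) //= -addrA lerDl.
    rewrite addr_ge0 ?ler0c ?ler0n //.
    by apply: sumr_ge0 => j _; exact: normr_ge0.
  rewrite rmorphD /= (@le_trans _ _ 2%:C) ?lerDr ?ler0c //.
  have -> : t k = `|(h 2 - \sum_(j < k) c j * 2 ^+ j)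
                    - (h 2 - \sum_(j < k.+1) c j * 2 ^+ j)|.
    by rewrite big_ord_recr /= /t; congr (`|_|); ring.
  rewrite (le_trans (ler_normB _ _)) // (_ : 2%:C = 1 + 1 :> R[i]) ?rmorphD //.
  by rewrite lerD // ltW // HN // (leq_trans Nk).
exists (2 * M); first by rewrite mulr_gt0.
move=> w n w1.
have pow2 k : (M / 2 ^+ k)%:C = M%:C / 2 ^+ k :> R[i].
  by rewrite fmorph_div rmorphXn /= rmorph_nat.
(* The bound telescopes: [M / 2^k = 2 M / 2^k - 2 M / 2^(k+1)]. *)
have step m : `|\sum_(k < n + m) c k * w ^+ k - \sum_(k < n) c k * w ^+ k|
    <= (2 * M / 2 ^+ n)%:C - (2 * M / 2 ^+ (n + m))%:C.
  elim: m => [|m IH]; first by rewrite addn0 !subrr normr0.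
  rewrite addnS big_ord_recr /= addrAC (le_trans (ler_normD _ _)) //.
  have -> : (2 * M / 2 ^+ n)%:C - (2 * M / 2 ^+ (n + m).+1)%:C =
    (2 * M / 2 ^+ n)%:C - (2 * M / 2 ^+ (n + m))%:C + (M / 2 ^+ (n + m))%:C.
    rewrite -!rmorphB -!rmorphD /= exprS; congr (_%:C).
    by field; rewrite ?expf_neq0 ?pnatr_eq0.
  apply: lerD => //; rewrite pow2 ler_pdivlMr ?exprn_gt0 ?ltr0n //.
  apply: le_trans (tM (n + m)%N); rewrite /t !normrM ler_pM //.
    by rewrite ler_piMr // normrX exprn_ile1.
  by rewrite normrX ger0_norm ?ler0n.
apply/ler_addgt0Pl => e e0; have [N' HN'] := is_pseries_near w ch e0.
have := HN' (n + N')%N (leq_addl _ _).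
rewrite -[h w - _](addrNK (\sum_(k < n + N') c k * w ^+ k)) => Hw.
have -> : h w - \sum_(k < n) c k * w ^+ k = h w - \sum_(k < n + N') c k * w ^+ k
   + (\sum_(k < n + N') c k * w ^+ k - \sum_(k < n) c k * w ^+ k) by ring.
rewrite (le_trans (ler_normD _ _)) // lerD //; last first.
  rewrite (le_trans (step N')) // gerBl ler0c.
  by rewrite divr_ge0 ?exprn_ge0 ?mulr_ge0 // ltW.
by rewrite ltW // HN' // leq_addl.
Qed.

(* Cauchy's estimate; averages over roots of unity replace the integral over the
   unit circle. *)
Lemma is_pseries_coef_le (R : realType) (c : nat -> R[i]) (h : R[i] -> R[i])
    (e : R[i]) k :
  is_pseries c h -> (forall w, `|w| <= 1 -> `|h w| <= e) -> `|c k| <= e.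
Proof.
move=> ch he; have [M M0 tM] := is_pseries_tail ch.
apply/ler_addgt0Pl => eta eta0.
have [eta' eta'0 etaE] : exists2 x : R, 0 < x & eta = x%:C.
  by exists (complex.Re eta); rewrite -?ltcR ?RRe_real ?gtr0_real.
(* [n > k] lets the average over the [n]-th roots of unity recover [c k], and [2^n > n > M / eta']
   makes the remainder at most [eta']. *)
pose n := (k + Num.bound (M / eta')).+1.
have kn : (k < n)%N by rewrite ltnS leq_addr.
have Mn : M / 2 ^+ n <= eta'.
  rewrite ler_pdivrMr ?exprn_gt0 // mulrC -ler_pdivrMr //.
  rewrite (le_trans (ltW (archi_boundP _))) ?divr_ge0 ?(ltW M0) ?(ltW eta'0) //.
  rewrite -natrX ler_nat (leq_trans _ (ltnW (ltn_expl n (ltnSn 1)))) //.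
  by rewrite /n leqW // leq_addl.
have [z zp] := prim_root_exists R[i] (ltn0Sn _ : 0 < n)%N.
have n0 : 0 < (n%:R : R[i]) by rewrite ltr0n.
have z1 j : `|z ^+ j| = 1.
  rewrite normrX (_ : `|z| = 1) ?expr1n //.
  apply/eqP; rewrite -(@pexpr_eq1 _ _ n) // -normrX.
  by rewrite (prim_expr_order zp) normr1.
rewrite -(ler_pM2r n0) -{1}[n%:R]ger0_norm ?ler0n // -normrM mulr_natr.
rewrite (coef_root_unity_avg c zp kn) (le_trans (ler_norm_sum _ _ _)) //.
rewrite mulr_natr -[n in _ *+ n]card_ord -sumr_const ler_sum // => j _.
rewrite normrM normfV z1 invr1 mul1r.
have zj : `|z ^+ j| <= 1 by rewrite z1.
set S := \sum_(m < n) _.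
rewrite -[S](subKr (h (z ^+ j))) [eta + e]addrC.
rewrite (le_trans (ler_normB _ _)) // lerD ?he //.
by apply: le_trans (tM _ n zj) _; rewrite etaE lecR.
Qed.

Lemma is_pseriesB (R : realType) (c c' : nat -> R[i]) (h h' : R[i] -> R[i]) :
  is_pseries c h -> is_pseries c' h' ->
  is_pseries (fun k => c k - c' k) (fun w => h w - h' w).
Proof.
move=> ch ch'; apply: is_pseriesP => w e e0.
have e2 : 0 < e / 2 by rewrite divr_gt0.
have [N HN] := is_pseries_near w ch e2.
have [N' HN'] := is_pseries_near w ch' e2.
exists (maxn N N') => n; rewrite geq_max => /andP[/HN hn /HN' hn'].
under eq_bigr => k _ do rewrite mulrBl.
rewrite sumrB (_ : _ - _ = (h w - \sum_(k < n) c k * w ^+ k)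
   - (h' w - \sum_(k < n) c' k * w ^+ k)); last by ring.
rewrite (le_lt_trans (ler_normB _ _)) // [e]splitr ltrD //.
Qed.

Lemma is_pseries_poly (R : realType) (q : {poly R[i]}) :
  is_pseries (fun k => q`_k) (horner q).
Proof.
apply: is_pseriesP => w e e0; exists (size q) => n qn.
by rewrite (horner_coef_wide _ qn) subrr normr0.
Qed.

Lemma is_pseries_conj (R : realType) (c : nat -> R[i]) (h : R[i] -> R[i]) :
  is_pseries c h -> is_pseries (fun k => (c k)^*) (conj_fun h).
Proof.
move=> ch; apply: is_pseriesP => w e e0.
have [N HN] := is_pseries_near (conjc w) ch e0; exists N => n /HN.
rewrite -normcJ rmorphB rmorph_sum /=.
by under eq_bigr => k _ do rewrite rmorphM rmorphXn /= conjcK.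
Qed.

(** The difference series has sum 0, so Cauchy's estimate applies with bound 0. *)
Lemma is_pseries_unique (R : realType) (c c' : nat -> R[i]) (h : R[i] -> R[i]) :
  is_pseries c h -> is_pseries c' h -> c =1 c'.
Proof.
move=> ch ch' k; apply/eqP; rewrite -subr_eq0 -normr_le0.
apply: (is_pseries_coef_le k (is_pseriesB ch ch')) => w _.
by rewrite subrr normr0.
Qed.

Lemma pseries_coefE (R : realType) (c : nat -> R[i]) (h : R[i] -> R[i]) :
  is_pseries c h -> pseries_coef h =1 c.
Proof.
move=> ch; rewrite /pseries_coef; case: xgetP => [c' _ ch'|/(_ c)//].
exact: is_pseries_unique ch' ch.
Qed.

Lemma pseries_coefP (R : realType) (h : R[i] -> R[i]) :
  entire h -> is_pseries (pseries_coef h) h.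
Proof. by move=> [c ch]; rewrite (funext (pseries_coefE ch)). Qed.

Lemma pseries_op_conj (R : realType) (h : R[i] -> R[i]) (p : {poly R[i]}) :
  entire h -> pseries_op (conj_fun h) (map_poly conjc p)
    = map_poly conjc (pseries_op h p).
Proof.
move=> /pseries_coefP /is_pseries_conj /pseries_coefE /funext hE.
by rewrite map_conj_diff_op /pseries_op hE.
Qed.

(** * Polynomial approximation on the unit disc *)

(** This continuous image of a product of segments contains the closed unit disc, where Cauchy's
    estimate needs the approximation. *)
Lemma compact_complex_square (R : realType) :
  compact ((fun xy : R * R => xy.1 +i* xy.2 : R[i]^o)
             @` (`[-1, 1] `*` `[-1, 1])).
Proof.
apply: continuous_compact; last by apply: compact_setX; exact: segment_compact.
apply: continuous_subspaceT => -[x y]; apply/cvgrPdist_lt => e e0.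
have eE : (complex.Re e)%:C = e by rewrite RRe_real ?gtr0_real.
have e'0 : 0 < complex.Re e / 2 by rewrite divr_gt0 // -ltcR eE.
near=> z; have [zx zy] : ball (x, y) (complex.Re e / 2) z.
  by near: z; exact: (nbhsx_ballx (x, y) _ e'0).
rewrite /ball /= in zx zy; rewrite [X in `|X|]complexE.
rewrite (le_lt_trans (ler_normD _ _)) // normrM.
have -> : `|'i : R[i]| = 1 by rewrite normc_def /= expr0n expr1n add0r sqrtr1.
rewrite mul1r !normc_def /= !expr0n /= !addr0 !sqrtr_sqr -rmorphD /= -eE ltcR.
by rewrite [X in _ < X]splitr ltrD.
Unshelve. all: by end_near.
Qed.

(** Being within [e] of [h] on the compact square defines a neighbourhood of [h], which meets the
    set of polynomials without zeros in [Omega]. *)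
Lemma closure_nonvanishing_near (R : realType) (Omega : set R[i])
    (h : R[i] -> R[i]) (e : R[i]) :
  closure_nonvanishing_poly Omega h -> 0 < e ->
  exists2 q : {poly R[i]}, (forall z, Omega z -> ~~ root q z)
    & forall w, `|w| <= 1 -> `|h w - q.[w]| <= e.
Proof.
move=> hcl e0.
have ent := @entourage_ball _ (R[i]^o : pseudoMetricType R[i]) (PosNum e0).
have [_ [[q qz ->] /= qh]] := hcl _
  (fam_nbhs (h : {family compact, R[i]^o -> R[i]^o}) ent
    (@compact_complex_square R)).
exists q => // w w1; apply/ltW/(qh w); exists (complex.Re w, complex.Im w).
  have {}w1 : `|w| <= 1%:C by [].
  rewrite normc_def lecR in w1.
  have := le_trans w1 (lexx 1); rewrite -[leRHS]sqrtr1 ler_sqrt // => w2.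
  have sub (x y : R) : x ^+ 2 + y ^+ 2 <= 1 -> (`[-1, 1] : set R) x.
    move=> xy; rewrite /= in_itv /= -ler_norml.
    rewrite -(@ler_pXn2r _ 2) ?nnegrE // real_normK ?num_real // expr1n.
    by have := sqr_ge0 y; lra.
  by split; [apply: (sub _ _ w2)|rewrite addrC in w2; apply: (sub _ _ w2)].
by case: (w).
Qed.

(** * The limit *)

Lemma size_diff_op (R : realType) (c : nat -> R[i]) (p : {poly R[i]}) :
  (size (diff_op c p) <= size p)%N.
Proof.
rewrite (leq_trans (size_sum _ _ _)) //; apply/bigmax_leqP => k _.
rewrite (leq_trans (size_scale_leq _ _)) //.
apply/leq_sizeP => j pj; rewrite coef_derivn nth_default ?mul0rn //.
exact: leq_trans (leq_addl _ _).
Qed.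

Lemma norm_diff_op_le (R : realType) (c c' : nat -> R[i]) (p : {poly R[i]})
    (e : R[i]) z :
  (forall k, `|c k - c' k| <= e) ->
  `|(diff_op c p).[z] - (diff_op c' p).[z]|
    <= e * \sum_(k < size p) `|p^`(k).[z]|.
Proof.
move=> cc'; rewrite /diff_op !horner_sum -sumrB mulr_sumr.
rewrite (le_trans (ler_norm_sum _ _ _)) // ler_sum // => k _.
by rewrite !hornerZ -mulrBl normrM ler_wpM2r.
Qed.

(* The approximants are [q(D) P + w (q(D) P)^*] with [q] near [h] and [w < 1]
   near [1]. *)
Lemma zero_free_real_part (R : realType) (d : R) (h : R[i] -> R[i])
    (P : {poly R[i]}) (H := pseries_op h P) :
  entire h -> closure_nonvanishing_poly (@lower_half_plane R) h ->
  conj_dominated d P -> H + map_poly conjc H != 0 ->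
  zero_free_above d (H + map_poly conjc H).
Proof.
move=> h_entire hcl Pd; apply: (@zero_free_limit _ _ (size P)) => z0 z1 e e0.
pose S z : R[i] := \sum_(k < size P) `|P^`(k).[z]|.
have S0 z : 0 <= S z by apply: sumr_ge0 => k _; exact: normr_ge0.
(* [t * B z] will bound the error at [z]: two terms come from replacing [h] by [q] at [z] and
   [conjc z], the last from replacing 1 by [1 - t]. *)
pose B z : R[i] := S z + S (conjc z) + `|H.[conjc z]|.
have B0 z : 0 <= B z by rewrite !addr_ge0.
(* The summands [1 + e] ensure [t < 1], and [t * B z < e] holds at both points. *)
pose t := e / (B z0 + B z1 + 1 + e).
have den0 : 0 < B z0 + B z1 + 1 + e by rewrite addr_gt0 // ltr_wpDl // addr_ge0.
have t0 : 0 < t by rewrite divr_gt0.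
have t1 : t < 1.
  by rewrite ltr_pdivrMr // mul1r ltrDr ltr_wpDl // addr_ge0.
have [q qz qh] := closure_nonvanishing_near hcl t0.
pose Q := diff_op (fun k => q`_k) P.
exists (Q + (1 - t) *: map_poly conjc Q).
have w1 : `|1 - t| < 1.
  by rewrite ger0_norm ?subr_ge0 ?(ltW t1) // gtrDl oppr_lt0.
have near z : B z <= B z0 + B z1 ->
  `|(Q + (1 - t) *: map_poly conjc Q).[z] - (H + map_poly conjc H).[z]| < e.
  move=> Bz; have QH x : `|Q.[x] - H.[x]| <= t * S x.
    (* Cauchy's estimate for [h - q] bounds every coefficient difference by [t]. *)
    apply: norm_diff_op_le => k; rewrite distrC.
    have hq := is_pseriesB (pseries_coefP h_entire) (@is_pseries_poly _ q).
    exact: is_pseries_coef_le hq qh.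
  rewrite !hornerD hornerZ !horner_conj.
  have -> : Q.[z] + (1 - t) * (Q.[conjc z])^* - (H.[z] + (H.[conjc z])^*)
    = Q.[z] - H.[z] + (1 - t) * (Q.[conjc z] - H.[conjc z])^*
      - t * (H.[conjc z])^* by rewrite rmorphB; ring.
  have tB : t * B z < e.
    rewrite /t mulrAC ltr_pdivrMr // ltr_pM2l // (le_lt_trans Bz) //.
    by rewrite -[ltRHS]addrA ltrDl addr_gt0.
  apply: le_lt_trans tB; rewrite !mulrDr.
  rewrite (le_trans (ler_normB _ _)) // lerD //; last first.
    by rewrite normrM normcJ ger0_norm // ltW.
  rewrite (le_trans (ler_normD _ _)) // lerD //.
  rewrite normrM normcJ (le_trans _ (QH (conjc z))) //.
  by rewrite ler_piMl // ltW.
split; [| |by apply: near; rewrite lerDl | by apply: near; rewrite lerDr].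
  by rewrite size_add_conj // size_diff_op.
(* If [q(D) P = 0], the approximant is the zero polynomial, which [zero_free_limit] admits. *)
have [Q0|/conj_dominatedP Qd] := conj_dominated_diff_op qz Pd.
  by left; rewrite /Q Q0 map_poly0 scaler0 addr0.
by right; apply: Qd.
Qed.

(** The zeros of a real polynomial are symmetric about the real axis. *)
Lemma strip_real_poly (R : rcfType) (d : R) (F : {poly R[i]}) :
  F \is a polyOver Num.real -> zero_free_above d F ->
  forall z, root F z -> `|complex.Im z| <= d.
Proof.
move=> Freal Fz z zF.
have Im_le x : root F x -> complex.Im x <= d.
  by move=> xF; rewrite leNgt; apply/negP => /Fz /negP; apply.
rewrite ler_norml Im_le // andbT lerNl.
have -> : - complex.Im z = complex.Im (conjc z) by case: (z).
apply: Im_le; rewrite /root; move: Freal; rewrite -map_conj_real => /eqP <-.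
by rewrite horner_conj conjcK conjc_eq0.
Qed.

Theorem theorem1p8 (R : realType) (mu lambda : R)
    (a : nat -> R[i]) (h : R[i] -> R[i]) (p : {poly R[i]})
    (mu_ge0 : 0 <= mu) (lambda_ge0 : 0 <= lambda)
    (h_entire : entire h)
    (T_factor : forall q : {poly R[i]},
       diff_op a q = pseries_op h (exp_op (lambda *i) q))
    (h_closure : closure_nonvanishing_poly (@lower_half_plane R) h)
    (p_strip : strip_poly mu p) :
  diff_op a p + diff_op (fun k => (a k)^*) p =
    pseries_op h (p \Po ('X + (lambda *i)%:P))
    + pseries_op (conj_fun h) (p \Po ('X - (lambda *i)%:P)) /\
  (strip_poly (Num.sqrt (Num.max (mu ^+ 2 - lambda ^+ 2) 0)) `|` [set 0])
    (diff_op a p + diff_op (fun k => (a k)^*) p).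
Proof.
have [p0 preal pmu] := p_strip.
(* As [p] is real, conjugating the coefficients of [T] conjugates the polynomial [T p]. *)
have aconj : diff_op (fun k => (a k)^*) p = map_poly conjc (diff_op a p).
  by move: preal; rewrite map_conj_diff_op -map_conj_real => /eqP ->.
rewrite aconj T_factor exp_op_comp.
rewrite -(map_conj_comp _ preal) (pseries_op_conj _ h_entire); split=> //.
set P := p \Po _; set H := pseries_op h P.
have [F0|F0] := eqVneq (H + map_poly conjc H) 0; [by right | left].
(* Conjugation exchanges the two summands, so it fixes their sum. *)
have Freal : H + map_poly conjc H \is a polyOver Num.real.
  rewrite -map_conj_real rmorphD /= -map_poly_comp [X in _ + X]map_poly_id.
    by rewrite addrC.
  by move=> x _ /=; rewrite conjcK.
split=> //; apply: strip_real_poly => //.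
exact: zero_free_real_part (conj_dominated_shift lambda_ge0 p0 preal pmu) F0.
Qed.
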